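(* Consider $\mathcal{C}ob_{/l}$ over $\mathbb{Z}$ with a special circle $S$, and the delooping isomorphism $\varphi: S\sqcup\bigcirc\to S\{-1\}\oplus S\{+1\}$ given in the context. Write $v_-$ for the summand $S\{-1\}$ and $v_+$ for the summand $S\{+1\}$, and write $v_{\epsilon_1}\otimes v_{\epsilon_2}$ for the summands obtained by delooping both non-special circles of $S\sqcup\bigcirc\bigcirc$. Let $H:S\to S$ be the connected tube of genus $1$ (special 1-handle operator). Then the maps induced under delooping by the genus-zero pairs of pants are as follows. (1) The map induced by the cobordism $S\sqcup\bigcirc\to S\sqcup\bigcirc\bigcirc$ (cylinder on $S$ disjoint union the splitting pair of pants) is $$\Delta_1:\quad v_+\mapsto v_+\otimes v_-+v_-\otimes v_+-H\,v_+\otimes v_+,\qquad v_-\mapsto v_-\otimes v_- .$$ (2) The map induced by $S\sqcup\bigcirc\bigcirc\to S\sqcup\bigcirc$ (cylinder on $S$ disjoint union the merging pair of pants) is $$m_1:\quad v_+\otimes v_+\mapsto v_+,\quad v_+\otimes v_-\mapsto v_-,\quad v_-\otimes v_+\mapsto v_-,\quad v_-\otimes v_-\mapsto H\,v_- .$$ (3) The map induced by the pair of pants $S\sqcup\bigcirc\to S$ merging the non-special circle into $S$ is $\Phi: v_-\mapsto H,\ v_+\mapsto 1$, and the map induced by the pair of pants $S\to S\sqcup\bigcirc$ is $\Psi$, sending $S$ to $v_-$ by the identity and to $v_+$ by $0$. (Here a formula such as $v_-\otimes v_-\mapsto H v_-$ means that the matrix entry from the summand $v_-\otimes v_-$ to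 the summand $v_-$ is the morphism $H:S\to S$, a coefficient $1$ means $\mathrm{id}_S$, and entries not displayed are $0$.)
   Context: The category $\mathcal{C}ob_{/l}$ over a commutative ground ring $R$ (here $R=\mathbb{Z}$): objects are finite (possibly empty) disjoint unions of circles $\bigcirc^n$, $n\ge 0$ ($\bigcirc^0=\emptyset$). Morphisms from $\bigcirc^n$ to $\bigcirc^m$ are formal $R$-linear combinations of compact orientable 2-dimensional cobordisms from $\bigcirc^n$ to $\bigcirc^m$ (abstract surfaces, not necessarily connected, possibly with closed components; circles and cobordisms are oriented compatibly with gluing and cobordisms are taken up to homeomorphism fixing the boundary, so a cobordism is determined by the partition of its boundary circles into connected components, the genus of each component, and the genera of its closed components), modulo the following local relations. Composition is gluing, extended bilinearly. - 4TU: if $D_1,D_2,D_3,D_4$ are four disjoint disks in the interior of a (not necessarily connected) cobordism $C$ and $C_{ij}$ denotes the cobordism obtained from $C$ by removing $D_i$ and $D_j$ and gluing in a tube (annulus, compatible with orientations) with the same boundary, then $C_{12}+C_{34}=C_{13}+C_{24}$. - S: a cobordism with a connected component that is a sphere equals $0$. - T: a connected component that is a torus may be removed and replaced by the factor $2$. $\mathrm{Mat}(\mathcal{C}ob_{/l})$ is the additive closure: objects are finite columns (formal direct sums) of objects, possibly with formal degree shifts $\{m\}$, and morphisms are matrices of morphisms. Delooping: $S$ is a distinguished (special) circle. Let $c=\mathrm{id}_S\sqcup(\text{disk }\bigcirc\to\emptyset)$, $u=\mathrm{id}_S\sqcup(\text{disk }\emptyset\to\bigcirc)$, $P:S\sqcup\bigcirc\to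 S$ and $Q:S\to S\sqcup\bigcirc$ the connected genus-zero pairs of pants. The delooping isomorphism $\varphi:S\sqcup\bigcirc\to S\{-1\}\oplus S\{+1\}$ has components $c$ (to $S\{-1\}$) and $P-H\circ c$ (to $S\{+1\}$); its inverse has components $Q$ (from $S\{-1\}$) and $u$ (from $S\{+1\}$). Several non-special circles are delooped one after another, with the same formulas. The map induced by a cobordism is its composition with the delooping isomorphism of the target and the inverse delooping isomorphism of the source. *)

(* Defs.v *)
From HB Require Import structures.
From mathcomp Require Import all_boot all_order all_algebra.
From mathcomp.multinomials Require Import freeg.

Set Implicit Arguments.
Unset Strict Implicit.
Unset Printing Implicit Defensive.

Import GRing.Theory.
Local Open Scope ring_scope.

(* A compact orientable surface with boundary circles labelled by [B], given by
   its finitely many connected components, the component carrying each boundary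
   circle, and the genus of each component.  Components that carry no boundary
   circle are the closed ones. *)
Record surface (B : finType) := Surface {
  ncomp : nat;
  comp_of : {ffun B -> 'I_ncomp};
  genus : {ffun 'I_ncomp -> nat} }.

Definition surface_pack (B : finType) (C : surface B) :
  {k : nat & ({ffun B -> 'I_k} * {ffun 'I_k -> nat})%type} :=
  Tagged (fun k => ({ffun B -> 'I_k} * {ffun 'I_k -> nat})%type)
    (comp_of C, genus C).
Definition surface_unpack (B : finType)
  (t : {k : nat & ({ffun B -> 'I_k} * {ffun 'I_k -> nat})%type}) : surface B :=
  Surface (tagged t).1 (tagged t).2.
Lemma surface_packK (B : finType) : cancel (@surface_pack B) (@surface_unpack B).
Proof. by case. Qed.
HB.instance Definition _ (B : finType) := Choice.copy (surface B) (can_type (@surface_packK B)).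

(* The surface whose components are the elements of an arbitrary [K]. *)
Definition mk_surface (B K : finType) (bd : B -> K) (g : K -> nat) : surface B :=
  Surface [ffun b => enum_rank (bd b)] [ffun k : 'I_#|K| => g (enum_val k)].

Definition homeo (B : finType) (C D : surface B) : Prop :=
  exists f : 'I_(ncomp C) -> 'I_(ncomp D),
    [/\ bijective f,
        forall b, comp_of D b = f (comp_of C b) &
        forall k, genus D (f k) = genus C k].

(* [join s t g bd] is obtained from connected pieces [x : T] of genus [g x] by
   connecting, for every [e : E], the pieces [s e] and [t e]: either by gluing a
   circle of the first to a circle of the second, or by removing an open disk
   from each and gluing in a tube.  The remaining boundary circle [b] lies on
   the piece [bd b].  For a component made of p pieces and q connections, the
   surface with its boundary capped off satisfies
     2 - 2 G = \sum (2 - 2 g x) - 2 q,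
   so that G = \sum g x + q + 1 - p; here p <= q + 1 by connectedness. *)
Section Join.
Variables (B T E : finType) (s t : E -> T) (g : T -> nat) (bd : B -> T).

Definition join_rel : rel T := fun x y =>
  [exists e, ((x == s e) && (y == t e)) || ((x == t e) && (y == s e))].

Lemma join_rel_sym : connect_sym join_rel.
Proof.
apply: sym_connect_sym => x y; apply/existsP/existsP => -[e He]; exists e;
  by rewrite orbC andbC [X in _ || X]andbC.
Qed.

Definition join_comp : finType := {x : T | roots join_rel x}.

Definition join_class (x : T) : join_comp :=
  exist _ (fingraph.root join_rel x) (roots_root join_rel_sym x).

Definition join_genus (k : join_comp) : nat :=
  (\sum_(x | join_class x == k) g x + #|[pred e | join_class (s e) == k]| + 1
   - #|[pred x | join_class x == k]|)%N.

Definition join : surface B :=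
  mk_surface (fun b => join_class (bd b)) join_genus.
End Join.

Definition add_tube (B : finType) (C : surface B) (a b : 'I_(ncomp C)) : surface B :=
  join (fun _ : unit => a) (fun _ : unit => b) (genus C) (comp_of C).

Definition add_closed (B : finType) (C : surface B) (h : nat) : surface B :=
  mk_surface (fun b => Some (comp_of C b))
    (fun k => if k is Some k then genus C k else h).

Definition formal (B : finType) := {freeg (surface B) / int}.

(* The subgroup generated by the relations.  In 4TU, [di] is the component
   containing the disk D_i; several of the disks may lie on one component. *)
Inductive null (B : finType) : formal B -> Prop :=
| null_homeo C D : homeo C D -> null (<< C >> - << D >>)
| null_4TU C (d1 d2 d3 d4 : 'I_(ncomp C)) :
    null (<< add_tube d1 d2 >> + << add_tube d3 d4 >>
          - (<< add_tube d1 d3 >> + << add_tube d2 d4 >>))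
| null_S C : null << add_closed C 0 >>
| null_T C : null (<< add_closed C 1 >> - << C >> *+ 2)
| null_zero : null 0
| null_sub x y : null x -> null y -> null (x - y).

(* The object made of [n] circles is represented by [n]; a morphism from [n] to
   [m] is a class of formal combinations of cobordisms modulo [hom_eq].  The
   boundary circles [inl i] are the sources and [inr j] the targets.  Since the
   relations hold inside an arbitrary cobordism, gluing and disjoint union of
   representatives descend to classes. *)
Definition cob (n m : nat) := surface ('I_n + 'I_m)%type.
Definition hom (n m : nat) := formal ('I_n + 'I_m)%type.
Definition hom_eq n m (f g : hom n m) : Prop := null (f - g).

Definition cob_connected (n m h : nat) : cob n m :=
  mk_surface (fun _ => tt) (fun _ => h).

Definition cob_id (n : nat) : cob n n :=
  mk_surface (fun b : 'I_n + 'I_n => match b with inl i => i | inr i => i end)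
    (fun _ => 0%N).

Definition cob_comp n m p (D : cob m p) (C : cob n m) : cob n p :=
  @join _ ('I_(ncomp C) + 'I_(ncomp D))%type 'I_m
    (fun e => inl (comp_of C (inr e))) (fun e => inr (comp_of D (inl e)))
    (fun x => match x with inl k => genus C k | inr k => genus D k end)
    (fun b => match b with
              | inl i => inl (comp_of C (inl i))
              | inr j => inr (comp_of D (inr j))
              end).

Definition cob_union n1 m1 n2 m2 (C : cob n1 m1) (D : cob n2 m2) :
    cob (n1 + n2) (m1 + m2) :=
  @mk_surface _ ('I_(ncomp C) + 'I_(ncomp D))%type
    (fun b => match b with
      | inl i => match split i with
                 | inl i1 => inl (comp_of C (inl i1))
                 | inr i2 => inr (comp_of D (inl i2))
                 end
      | inr j => match split j with
                 | inl j1 => inl (comp_of C (inr j1))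
                 | inr j2 => inr (comp_of D (inr j2))
                 end
      end)
    (fun x => match x with inl k => genus C k | inr k => genus D k end).

Definition hom_id n : hom n n := << cob_id n >>.

Definition hom_comp n m p (g : hom m p) (f : hom n m) : hom n p :=
  fglift (fun D => fglift (fun C => << cob_comp D C >> : hom n p) f) g.

Definition hom_union n1 m1 n2 m2 (f : hom n1 m1) (g : hom n2 m2) :
    hom (n1 + n2) (m1 + m2) :=
  fglift (fun C => fglift (fun D => << cob_union C D >> : hom _ _) g) f.

(* The additive closure: finite families of shifted objects, and matrices. *)
Record matobj := MatObj {
  idx : finType;
  circles : idx -> nat;
  shift : idx -> int }.

(* [f i j] is the entry from the summand [i] of [X] to the summand [j] of [Y]. *)
Definition mathom (X Y : matobj) :=
  forall (i : idx X) (j : idx Y), hom (circles i) (circles j).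

Definition mat_comp X Y Z (g : mathom Y Z) (f : mathom X Y) : mathom X Z :=
  fun i k => \sum_(j : idx Y) hom_comp (g j k) (f i j).

Definition mat_eq X Y (f g : mathom X Y) : Prop :=
  forall i j, hom_eq (f i j) (g i j).

Definition single (n : nat) : matobj :=
  @MatObj unit (fun _ => n) (fun _ => 0).
Definition mat_single n m (f : hom n m) : mathom (single n) (single m) :=
  fun _ _ => f.

(* Circle 0 is the special circle S, so that [1 + k] is S together with [k]
   non-special circles. *)
Definition H : hom 1 1 := << cob_connected 1 1 1 >>.
Definition merge : hom 2 1 := << cob_connected 2 1 0 >>.
Definition splitting : hom 1 2 := << cob_connected 1 2 0 >>.
Definition cap : hom (1 + 1) (1 + 0) :=
  hom_union (hom_id 1) << cob_connected 1 0 0 >>.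
Definition cup : hom (1 + 0) (1 + 1) :=
  hom_union (hom_id 1) << cob_connected 0 1 0 >>.

(* A sign is a boolean; [vp] stands for v_+ and [vm] for v_-. *)
Notation vp := true (only parsing).
Notation vm := false (only parsing).

Definition phi (e : bool) : hom 2 1 :=
  if e then merge - hom_comp H cap else cap.
Definition phi_inv (e : bool) : hom 1 2 :=
  if e then cup else splitting.

(* S with [k] circles, delooped: the summand [e] is v_{e1} (x) ... (x) v_{ek},
   a copy of S. *)
Definition delooped (k : nat) : matobj :=
  @MatObj (k.-tuple bool : finType) (fun _ => 1%N)
    (fun e => \sum_(b <- e) (if b then 1 else -1)).

(* The iterated delooping of S with [k] circles, starting with the first
   non-special circle.  The later deloopings act on each summand separately, so
   the product of these block-diagonal matrices involves no sum. *)
Fixpoint deloop_entry (k : nat) : k.-tuple bool -> hom (1 + k) 1 :=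
  if k is k'.+1 then fun e =>
    hom_comp (deloop_entry (behead_tuple e))
             (hom_union (phi (thead e)) (hom_id k') : hom (1 + k'.+1) (1 + k'))
  else fun _ => hom_id 1.

Fixpoint deloop_inv_entry (k : nat) : k.-tuple bool -> hom 1 (1 + k) :=
  if k is k'.+1 then fun e =>
    hom_comp (hom_union (phi_inv (thead e)) (hom_id k') : hom (1 + k') (1 + k'.+1))
             (deloop_inv_entry (behead_tuple e))
  else fun _ => hom_id 1.

Definition deloop k : mathom (single (1 + k)) (delooped k) :=
  fun _ e => deloop_entry e.
Definition deloop_inv k : mathom (delooped k) (single (1 + k)) :=
  fun e _ => deloop_inv_entry e.

Definition induced k l (f : hom (1 + k) (1 + l)) :
    mathom (delooped k) (delooped l) :=
  mat_comp (@deloop l) (mat_comp (mat_single f) (@deloop_inv k)).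

(* The matrix whose entry from v_e to v_f is [F e f]. *)
Definition table k l (F : seq bool -> seq bool -> hom 1 1) :
    mathom (delooped k) (delooped l) :=
  fun e f => F (tval e) (tval f).

(* Main.v *)
From HB Require Import structures.
From mathcomp Require Import all_boot all_order all_algebra.
From mathcomp.multinomials Require Import freeg.
From mathcomp Require Import zify.
Require Import Defs.

(** Expanding all the deloopings, every matrix entry is an integer combination
    of cobordisms from S to S, each of which is either connected or contains a
    sphere component.  The latter vanish by relation S, the former are determined
    by their genus, and the coefficients are compared genus by genus.  The
    compositions are evaluated on combinatorial codes of surfaces, where circles
    are glued one at a time. *)

Set Implicit Arguments.
Unset Strict Implicit.
Unset Printing Implicit Defensive.

Import GRing.Theory.
Local Open Scope ring_scope.

(** * Combinatorial codes of cobordisms *)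

(** Makes the additive-morphism lemmas [raddf0] and [raddfD] available for the linear extension
    [fglift]. *)
HB.instance Definition _ (K : choiceType) (M : lmodType int) (f : K -> M) :=
  GRing.isZmodMorphism.Build {freeg K / int} M (fglift f) (lift_is_additive f).

(* The components are named by arbitrary natural numbers, listed in [d_labels]
   possibly with repetitions; the fields are junk outside of the circles and of
   the labels in use. *)
Record diagram := Diagram {
  d_in : nat -> nat;
  d_out : nat -> nat;
  d_labels : seq nat;
  d_genus : nat -> nat }.

Definition represents n m (C : cob n m) (M : diagram) : Prop :=
  exists f : 'I_(ncomp C) -> nat,
    [/\ injective f,
        forall i : 'I_n, d_in M i = f (comp_of C (inl i)),
        forall j : 'I_m, d_out M j = f (comp_of C (inr j)),
        d_labels M =i codom f &
        forall k, d_genus M (f k) = genus C k].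

(** Components can be labelled directly by [K]: the enumeration of [K] hidden in [mk_surface] is
    absorbed by precomposing [f] with [enum_val]. *)
Lemma represents_mk_surface n m (K : finType) (bd : 'I_n + 'I_m -> K)
    (g : K -> nat) (f : K -> nat) (M : diagram) :
    injective f ->
    (forall i : 'I_n, d_in M i = f (bd (inl i))) ->
    (forall j : 'I_m, d_out M j = f (bd (inr j))) ->
    d_labels M =i codom f ->
    (forall k, d_genus M (f k) = g k) ->
  represents (mk_surface bd g : cob n m) M.
Proof.
move=> f_inj Min Mout Mlab Mgen; exists (f \o @enum_val K K); split=> /=.
- by apply: inj_comp => //; apply: enum_val_inj.
- by move=> i; rewrite ffunE enum_rankK.
- by move=> j; rewrite ffunE enum_rankK.
- move=> l; rewrite Mlab; apply/codomP/codomP => -[k ->].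
    by exists (enum_rank k); rewrite /= enum_rankK.
  by exists (enum_val k).
- by move=> k; rewrite ffunE Mgen.
Qed.

Definition diag_connected h :=
  Diagram (fun=> 0%N) (fun=> 0%N) [:: 0%N] (fun=> h).
Definition diag_id n := Diagram id id (iota 0 n) (fun=> 0%N).

(* In a disjoint union, even labels are used on the left, odd ones on the right. *)
Definition sum_label (T U : Type) (f : T -> nat) (g : U -> nat) (x : T + U) :=
  match x with inl t => (f t).*2 | inr u => (g u).*2.+1 end.

Definition sum_genus (f g : nat -> nat) (l : nat) : nat :=
  if odd l then g l./2 else f l./2.

Definition sum_labels (s t : seq nat) : seq nat :=
  map double s ++ map (succn \o double) t.

Definition diag_union n1 m1 (M N : diagram) : diagram :=
  Diagram
    (fun i => if (i < n1)%N then (d_in M i).*2 else (d_in N (i - n1)).*2.+1)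
    (fun j => if (j < m1)%N then (d_out M j).*2 else (d_out N (j - m1)).*2.+1)
    (sum_labels (d_labels M) (d_labels N))
    (sum_genus (d_genus M) (d_genus N)).

(* [st] consists of the genera of the current components and of the map sending
   every initial label to its current one.  When [e] joins two components, the
   second one takes the label of the first. *)
Definition glue_circle (st : (nat -> nat) * (nat -> nat)) (e : nat * nat) :=
  let a := st.2 e.1 in let b := st.2 e.2 in
  let h := (st.1 a + (if a == b then 1 else st.1 b))%N in
  (fun l => if l == a then h else st.1 l,
   fun l => let l' := st.2 l in if l' == b then a else l').

(** Starts from the even/odd labels of a disjoint union and glues the [m] middle circles in turn.
    Relabelling sends several initial labels to one, which is why label lists may repeat. *)
Definition diag_comp m (N M : diagram) : diagram :=
  let st := foldl glue_circle (sum_genus (d_genus M) (d_genus N), id)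
    [seq ((d_out M i).*2, (d_in N i).*2.+1) | i <- iota 0 m] in
  Diagram (fun i => st.2 (d_in M i).*2) (fun j => st.2 (d_out N j).*2.+1)
    (map st.2 (sum_labels (d_labels M) (d_labels N))) st.1.

Lemma represents_connected n m h :
  represents (cob_connected n m h) (diag_connected h).
Proof.
apply: (represents_mk_surface (f := fun=> 0%N)) => //= [[] [] //|l].
rewrite inE; apply/eqP/codomP => [->|[] //].
by exists tt.
Qed.

Lemma represents_id n : represents (cob_id n) (diag_id n).
Proof.
apply: (represents_mk_surface (f := @nat_of_ord n)) => //= [|l].
  exact: val_inj.
rewrite mem_iota add0n; apply/idP/codomP => [l_n|[k ->]].
  by exists (Ordinal l_n).
exact: ltn_ord.
Qed.

Lemma sum_label_inj (T U : Type) (f : T -> nat) (g : U -> nat) :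
  injective f -> injective g -> injective (sum_label f g).
Proof.
move=> f_inj g_inj [t|u] [t'|u'] /= E.
- by rewrite (f_inj t t') //; apply: double_inj.
- by have := congr1 odd E; rewrite /= !odd_double.
- by have := congr1 odd E; rewrite /= !odd_double.
- by case: E => /double_inj/g_inj ->.
Qed.

Lemma sum_genusE (T U : Type) (f : T -> nat) (g : U -> nat) (F G : nat -> nat) x :
  sum_genus F G (sum_label f g x) =
  match x with inl t => F (f t) | inr u => G (g u) end.
Proof.
case: x => [t|u]; rewrite /sum_genus /= odd_double ?doubleK //=.
by rewrite uphalf_double.
Qed.

Lemma sum_labelsE (T U : finType) (f : T -> nat) (g : U -> nat) s t :
  s =i codom f -> t =i codom g -> sum_labels s t =i codom (sum_label f g).
Proof.
move=> sf tg l; rewrite mem_cat; apply/orP/codomP => [[]|[[x|x] ->]].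
- by case/mapP=> k; rewrite sf => /codomP[x ->] ->; exists (inl x).
- by case/mapP=> k; rewrite tg => /codomP[x ->] ->; exists (inr x).
- by left; apply: map_f; rewrite sf codom_f.
- by right; apply/mapP; exists (g x); rewrite // tg codom_f.
Qed.

Lemma represents_union n1 m1 n2 m2 (C : cob n1 m1) (D : cob n2 m2) M N :
    represents C M -> represents D N ->
  represents (cob_union C D) (diag_union n1 m1 M N).
Proof.
case=> [f [f_inj f_in f_out f_lab f_gen]] [g [g_inj g_in g_out g_lab g_gen]].
apply: (represents_mk_surface (f := sum_label f g)) => /=.
- exact: sum_label_inj.
- by move=> i; case: splitP => k ->; rewrite /= ?f_in // addKn g_in.
- by move=> i; case: splitP => k ->; rewrite /= ?f_out // addKn g_out.
- exact: sum_labelsE.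
- by move=> k; rewrite sum_genusE; case: k.
Qed.

(** * Gluing one circle at a time *)

Section Gluing.
Variables (T : finType) (g f : T -> nat) (G : nat -> nat).
Hypothesis f_inj : injective f.
Hypothesis fG : forall x, G (f x) = g x.
Implicit Types (es : seq (T * T)) (st : (nat -> nat) * (nat -> nat)).

Definition edge_rel es : rel T := fun x y => ((x, y) \in es) || ((y, x) \in es).

(* The correctness of the state [st] reached from the labelling [f] of the pieces
   [x : T] after the connections [es]; the truncated subtraction of [join_genus]
   is turned into an addition. *)
Definition glued es st : Prop :=
  [/\ forall x y, st.2 (f x) = st.2 (f y) <-> connect (edge_rel es) x y &
      forall x, (st.1 (st.2 (f x)) + \sum_(y | st.2 (f y) == st.2 (f x)) 1 =
        \sum_(y | st.2 (f y) == st.2 (f x)) g y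
        + count (fun e => st.2 (f e.1) == st.2 (f x)) es + 1)%N].

Lemma glued_nil : glued [::] (G, id).
Proof.
split=> /= [x y|x].
  split=> [/f_inj-> //|/connectP[[|z p] //= _ ->] //].
by rewrite !(big_pred1 x) => [|y|y]; rewrite ?inj_eq // fG addn0.
Qed.

(** An edge inside one component raises its genus by one. An edge between two components makes
    genera, numbers of pieces and numbers of edges add up. *)
Lemma glued_cons es st e :
  glued es st -> glued (e :: es) (glue_circle st (f e.1, f e.2)).
Proof.
case: e st => x0 y0 [G' r] [/= conn gen].
set a := r (f x0); set b := r (f y0).
pose r' l := if r l == b then a else r l.
have sub x y :
    connect (edge_rel es) x y -> connect (edge_rel ((x0, y0) :: es)) x y.
  by apply: connect_sub => u v /orP uv; apply: connect1;
     rewrite /edge_rel !inE; case: uv => ->; rewrite ?orbT.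
have sym : connect_sym (edge_rel ((x0, y0) :: es)).
  by apply: sym_connect_sym => u v; rewrite /edge_rel orbC.
have conn0 : connect (edge_rel ((x0, y0) :: es)) x0 y0.
  by apply: connect1; rewrite /edge_rel !inE eqxx.
(* The new labels are constant along every edge, hence on every connected component; this gives one
   direction of the equivalence. *)
have edge u v : edge_rel ((x0, y0) :: es) u v -> r' (f u) = r' (f v).
  have r'0 : r' (f x0) = r' (f y0).
    by rewrite /r' eqxx; case: ifP.
  have r'1 x y : (x, y) \in es -> r' (f x) = r' (f y).
    move=> xy; rewrite /r' (_ : r (f x) = r (f y)) //.
    by apply/conn/connect1; rewrite /edge_rel xy.
  rewrite /edge_rel !inE -!orbA => /or4P[/eqP[-> ->]|/r'1|/eqP[-> ->]|/r'1] //.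
rewrite /glue_circle /= -/a -/b.
split=> [x y|x] /=; first split.
- rewrite -/(r' (f x)) -/(r' (f y)) /r'.
  (* If exactly one of [x], [y] lay in the component of [y0], the path between them crosses the new
     edge. *)
  case: eqP => xb; case: eqP => yb.
  + by move=> _; apply/sub/conn; rewrite xb yb.
  + move=> ay; apply: connect_trans (_ : connect _ x y0) _.
      by apply/sub/conn.
    rewrite sym; apply: connect_trans (_ : connect _ y x0) _ => //.
    by apply/sub/conn.
  + move=> xa; apply: connect_trans (_ : connect _ x x0) _.
      by apply/sub/conn.
    apply: connect_trans conn0 _.
    by apply/sub/conn.
  + by move=> xy; apply/sub/conn.
- case/connectP=> p; elim: p x => [|z p IH] x /= => [_ -> //|].
  by case/andP=> /edge xz pz yl; apply: etrans xz (IH z pz yl).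
- rewrite -/(r' (f x)).
  (* When [a = b] no label changes: the extra edge is matched by the extra handle. *)
  have [ab|nab] := eqVneq a b.
    have r'E l : r' l = r l by rewrite /r' ab; case: eqP.
    rewrite r'E.
    under eq_bigl do rewrite -/(r' (f _)) r'E.
    under [in RHS]eq_bigl do rewrite -/(r' (f _)) r'E.
    under eq_count do rewrite -/(r' (f _)) r'E.
    by have := gen x; rewrite [r (f x) == a]eq_sym; case: eqP => [->|_]; lia.
  (* A component other than the merged one keeps its label, pieces and edges. *)
  have [xa|xa] := eqVneq (r' (f x)) a; last first.
    have xb : r (f x) != b.
      by apply: contra_neq xa; rewrite /r' => ->; rewrite eqxx.
    have r'x : r' (f x) = r (f x) by rewrite /r' (negPf xb).
    have r'E y : (r' (f y) == r' (f x)) = (r (f y) == r (f x)).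
      rewrite r'x {1}/r'; have [->|//] := eqVneq (r (f y)) b.
      by rewrite ![_ == r (f x)]eq_sym (negPf xb) -r'x (negPf xa).
    under eq_bigl do rewrite -/(r' (f _)) r'E.
    under [in RHS]eq_bigl do rewrite -/(r' (f _)) r'E.
    under eq_count do rewrite -/(r' (f _)) r'E.
    by rewrite -gen r'x.
  (* The merged class is the disjoint union of the old classes of [a] and [b], so sums and counts
     split. *)
  have r'E y : (r' (f y) == a) = (r (f y) == a) || (r (f y) == b).
    by rewrite /r'; case: (r (f y) == b); rewrite ?eqxx ?orbT ?orbF.
  have split_sum F : (\sum_(y | r' (f y) == a) F y =
      \sum_(y | r (f y) == a) F y + \sum_(y | r (f y) == b) F y)%N.
    rewrite (bigID (fun y => r (f y) == a)) /=; congr (_ + _)%N.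
      by apply: eq_bigl => y; rewrite r'E andb_idl // => ->.
    apply: eq_bigl => y; rewrite r'E.
    by have [->|] := eqVneq (r (f y)) a; rewrite ?andbF ?andbT // (negPf nab).
  have split_count : (count (fun e => r' (f e.1) == a) es =
      count (fun e => r (f e.1) == a) es + count (fun e => r (f e.1) == b) es)%N.
    rewrite -count_predUI [X in (_ + X)%N](_ : _ = 0%N).
      by rewrite addn0; apply: eq_count => z; rewrite r'E.
    rewrite -(count_pred0 es); apply: eq_count => z /=.
    by case: eqP => // ->; rewrite (negPf nab).
  (* Adding the two old equations leaves two constants 1; one of them counts the new edge. *)
  have := gen x0; have := gen y0; rewrite -/a -/b => gy0 gx0.
  rewrite xa -/a /= !split_sum split_count; lia.
Qed.

(** Each processed edge is put in front, so edges accumulate in reverse order; [catrev] records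
    this. *)
Lemma glued_foldl es es' st :
  glued es st ->
  glued (catrev es' es) (foldl glue_circle st [seq (f e.1, f e.2) | e <- es']).
Proof. by elim: es' es st => [|e es' IH] es st // gl; apply/IH/glued_cons. Qed.

End Gluing.

(** By the gluing invariant, final labels agree exactly on pieces connected by [join_rel], so the
    label of the root is an injective code of the component. *)
Lemma represents_join n m (T E : finType) (s t : E -> T) (g : T -> nat)
    (bd : 'I_n + 'I_m -> T) (f : T -> nat) (G : nat -> nat) (V : seq nat) (M : diagram) :
    injective f -> (forall x, G (f x) = g x) -> V =i codom f ->
    let st := foldl glue_circle (G, id) [seq (f (s e), f (t e)) | e <- enum E] in
    (forall i : 'I_n, d_in M i = st.2 (f (bd (inl i)))) ->
    (forall j : 'I_m, d_out M j = st.2 (f (bd (inr j)))) ->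
    d_labels M = map st.2 V -> d_genus M = st.1 ->
  represents (join s t g bd : cob n m) M.
Proof.
move=> f_inj fG Vf st Min Mout MV MG.
pose es := [seq (s e, t e) | e <- enum E].
have [conn gen] : glued g f (catrev es [::]) st.
  rewrite /st (_ : map _ _ = [seq (f e.1, f e.2) | e <- es]).
    by apply: glued_foldl => //; apply: glued_nil.
  by rewrite /es -map_comp.
have relE : edge_rel (catrev es [::]) =2 join_rel s t.
  move=> x y; rewrite /edge_rel !mem_rev; apply/orP/existsP.
    by case=> /mapP[e _ [-> ->]]; exists e; rewrite !eqxx ?orbT.
  case=> e /orP[]/andP[/eqP-> /eqP->]; [left|right];
    by apply: map_f; rewrite mem_enum.
have connE x y : (st.2 (f x) == st.2 (f y)) = connect (join_rel s t) x y.
  by rewrite -(eq_connect relE); apply/eqP/idP => /conn.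
have symc := join_rel_sym s t.
have classE x k : (join_class s t x == k) = (st.2 (f x) == st.2 (f (val k))).
  by rewrite connE -root_connect // -val_eqE /= (eqP (valP k)).
apply: (represents_mk_surface
  (f := fun k : join_comp s t => st.2 (f (val k)))).
- move=> k l /= kl; apply/eqP.
  rewrite -[k == l]val_eqE -(eqP (valP k)) -(eqP (valP l)).
  by rewrite root_connect // -connE kl.
- by move=> i; rewrite Min; apply/eqP; rewrite -classE.
- by move=> i; rewrite Mout; apply/eqP; rewrite -classE.
- move=> l; rewrite MV; apply/mapP/codomP => [[l' + ->]|[k ->]].
    rewrite Vf => /codomP[x ->]; exists (join_class s t x).
    by apply/eqP; rewrite -classE.
  by exists (f (val k)) => //; rewrite Vf codom_f.
- move=> k; rewrite MG /join_genus.
  have sumE F : (\sum_(x | join_class s t x == k) F x =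
      \sum_(y | st.2 (f y) == st.2 (f (val k))) F y)%N.
    by apply: eq_bigl => y; apply: classE.
  have -> : #|[pred x | join_class s t x == k]| =
      (\sum_(y | st.2 (f y) == st.2 (f (val k))) 1)%N.
    by rewrite -sum1_card -sumE.
  have -> : #|[pred e | join_class s t (s e) == k]| =
      count (fun e => st.2 (f e.1) == st.2 (f (val k))) (catrev es [::]).
    rewrite count_rev count_map -sum1_card -sum1_count big_enum_cond.
    by apply: eq_bigl => e; rewrite inE classE.
  (* The invariant writes the minuend as the genus plus the number of pieces, so the truncated
     subtraction is exact. *)
  by rewrite sumE -gen addnK.
Qed.

Lemma represents_comp n m p (D : cob m p) (C : cob n m) N M :
    represents D N -> represents C M ->
  represents (cob_comp D C) (diag_comp m N M).
Proof.
case=> [g [g_inj g_in g_out g_lab g_gen]] [f [f_inj f_in f_out f_lab f_gen]].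
have E : [seq ((d_out M i).*2, (d_in N i).*2.+1) | i <- iota 0 m] =
  [seq (sum_label f g (inl (comp_of C (inr e))),
        sum_label f g (inr (comp_of D (inl e)))) | e <- enum 'I_m].
  rewrite -val_enum_ord -map_comp; apply: eq_map => i /=.
  by rewrite f_out g_in.
apply: (represents_join (f := sum_label f g)
  (G := sum_genus (d_genus M) (d_genus N))
  (V := sum_labels (d_labels M) (d_labels N))) => //=.
- exact: sum_label_inj.
- by move=> x; rewrite sum_genusE; case: x.
- exact: sum_labelsE.
- by move=> i; rewrite -E -f_in.
- by move=> i; rewrite -E -g_out.
- by rewrite -E.
- by rewrite -E.
Qed.

(** * Vanishing combinations *)

Lemma null_opp (B : finType) (x : formal B) : null x -> null (- x).
Proof. by rewrite -sub0r; apply: null_sub; apply: null_zero. Qed.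

Lemma null_add (B : finType) (x y : formal B) : null x -> null y -> null (x + y).
Proof. by move=> nx /null_opp; rewrite -{2}[y]opprK; apply: null_sub. Qed.

Lemma null_scale (B : finType) z (x : formal B) : null x -> null (z *: x).
Proof.
move=> nx; have nat_scale k : null (k%:Z *: x).
  rewrite -[k%:Z]intz scaler_int; elim: k => [|k IH]; first exact: null_zero.
  by rewrite -pmulrn mulrS; apply: null_add.
case: z => k; first exact: nat_scale.
by rewrite NegzE scaleNr; apply: null_opp.
Qed.

(** Since labels may repeat, connectedness means that all of them coincide; the empty surface is
    excluded. *)
Definition diag_is_connected (M : diagram) : bool :=
  if d_labels M is l :: s then all (pred1 l) s else false.

Definition diag_total_genus (M : diagram) : nat := d_genus M (head 0%N (d_labels M)).

(** Injectivity of the labelling and equality of all labels force a single component, so only its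
    genus remains. *)
Lemma homeo_connected n m (C : cob n m) M :
    represents C M -> diag_is_connected M ->
  homeo C (cob_connected n m (diag_total_genus M)).
Proof.
case=> f [f_inj _ _ f_lab f_gen]; rewrite /diag_is_connected /diag_total_genus.
case: (d_labels M) f_lab => //= l s f_lab /allP s_l.
have fl k : f k = l.
  have : f k \in l :: s by rewrite f_lab codom_f.
  by rewrite inE => /predU1P[|/s_l/eqP].
have [k0 _] : exists k0, l = f k0 by apply/codomP; rewrite -f_lab mem_head.
exists (fun=> enum_rank tt); split.
- exists (fun=> k0) => k; first by apply: f_inj; rewrite !fl.
  by apply: enum_val_inj; case: (enum_val _) (enum_val _) => -[].
- by move=> b; rewrite /= ffunE.
- by move=> k; rewrite /= ffunE -f_gen fl.
Qed.

Definition diag_has_sphere n m (M : diagram) : bool :=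
  has (fun l => [&& d_genus M l == 0%N, all (fun i => d_in M i != l) (iota 0 n)
                  & all (fun j => d_out M j != l) (iota 0 m)]) (d_labels M).

(** Up to homeomorphism, [C] is the surface without [k0] to which a closed sphere is added, so
    relation S applies. *)
Lemma null_closed_sphere (B : finType) (C : surface B) (k0 : 'I_(ncomp C)) :
  genus C k0 = 0%N -> (forall b, comp_of C b != k0) -> null << C >>.
Proof.
move=> gk0 bk0.
pose K : finType := {k : 'I_(ncomp C) | k != k0}.
pose C' := mk_surface (fun b => exist (fun k => k != k0) _ (bk0 b) : K)
  (fun k => genus C (val k)).
suff CC' : homeo C (add_closed C' 0).
  rewrite -[X in null X](subrK << add_closed C' 0 >>).
  by apply: null_add; [apply: null_homeo | apply: null_S].
(* [insub] sends [k0] to [None], the added sphere, and every other component to itself in [K]. *)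
exists (fun k => enum_rank (omap enum_rank (insub k : option K))); split.
- exists (fun j : 'I_#|{: option 'I_#|K|}| =>
    oapp (fun i => val (enum_val i)) k0 (enum_val j)) => [k|j].
    rewrite enum_rankK; case: insubP => [u _ uk|/negbNE/eqP->] //=.
    by rewrite enum_rankK.
  apply: (canLR enum_valK); case: (enum_val j) => [i|] /=.
    by rewrite valK /= enum_valK.
  by rewrite insubF ?eqxx.
- move=> b; rewrite /= !ffunE; congr (enum_rank _).
  by rewrite (insubT (fun k => k != k0) (bk0 b)) /=.
- move=> k; rewrite /= ffunE enum_rankK; case: insubP => [u _ <-|/negbNE/eqP->] //=.
  by rewrite ffunE enum_rankK.
Qed.

Lemma null_sphere n m (C : cob n m) M :
  represents C M -> diag_has_sphere n m M -> null << C >>.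
Proof.
case=> f [f_inj f_in f_out f_lab f_gen] /hasP[l].
rewrite f_lab => /codomP[k ->] /and3P[/eqP gk /allP Min /allP Mout].
apply: (null_closed_sphere (k0 := k)); first by rewrite -f_gen.
case=> i; apply/eqP => ik.
  by have := Min i; rewrite mem_iota ltn_ord f_in ik eqxx => /(_ isT).
by have := Mout i; rewrite mem_iota ltn_ord f_out ik eqxx => /(_ isT).
Qed.

Lemma freegU_scale (K : choiceType) z (x : K) :
  << z *g x >> = z *: << x >> :> {freeg K / int}.
Proof. by rewrite -[z in RHS]intz scaler_int freegU_mulz intz. Qed.

(** Ties a formal combination to a list of coded terms that can be evaluated; like terms need not be
    collected. *)
Inductive lincomb n m : hom n m -> seq (int * diagram) -> Prop :=
| lincomb_nil : lincomb 0 [::]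
| lincomb_cons z C M x L : represents C M -> lincomb x L ->
    lincomb (<< z *g C >> + x) ((z, M) :: L).

Definition cancels (s : seq (int * nat)) : bool :=
  all (fun p => foldr (fun q a => if q.2 == p.2 then q.1 + a else a) 0 s == 0)
    s.

Lemma cancelsP (s : seq (int * nat)) :
  cancels s -> [freeg s] = 0 :> {freeg nat / int}.
Proof.
move=> /allP s0; apply/eqP/freeg_eqP => h; rewrite coeff0 coeff_Freeg /precoeff.
have [/mapP[p ps ->]|hs] := boolP (h \in map snd s).
  rewrite -[RHS](eqP (s0 p ps)); elim: (s) => [|q s' IH].
    by rewrite big_nil.
  by rewrite big_cons IH.
rewrite big_seq_cond big_pred0 // => p; apply/negbTE; apply: contra hs.
by case/andP=> ps /eqP<-; apply: map_f.
Qed.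

Definition lincomb_vanishes n m (L : seq (int * diagram)) : bool :=
  let L' := [seq p <- L | ~~ diag_has_sphere n m p.2] in
  all (fun p => diag_is_connected p.2) L' &&
  cancels [seq (p.1, diag_total_genus p.2) | p <- L'].

(** Modulo [null], sphere terms disappear and each remaining term is determined by its genus, so
    cancellation genus by genus suffices. *)
Lemma lincomb_null n m (x : hom n m) L :
  lincomb x L -> lincomb_vanishes n m L -> null x.
Proof.
move=> xL /andP[conn /cancelsP c0].
pose conn_lift := fglift (fun h => << cob_connected n m h >> : hom n m).
(* The subtracted zero becomes the image under [conn_lift] of the cancelling genus list, and the
   induction compares both sides term by term. *)
rewrite -[x]subr0; have <- : conn_lift 0 = 0.
  exact: raddf0.
rewrite -{}c0 {}/conn_lift; elim: xL conn => [|z C M y {}L CM _ IH] /=.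
  by rewrite fglift_Freeg prelift_nil subr0 => _; apply: null_zero.
case: ifPn => [_ /= /andP[cM /IH]|/negbNE sM /IH]; last first.
  rewrite -addrA freegU_scale; apply: null_add.
  by apply: null_scale; apply: null_sphere CM sM.
rewrite !fglift_Freeg prelift_cons opprD addrACA freegU_scale -scalerBr /=.
by apply: null_add; apply: null_scale; apply: null_homeo; apply: homeo_connected.
Qed.

(** * Evaluation of the deloopings *)

Definition lin_bilin (op : diagram -> diagram -> diagram)
    (L1 L2 : seq (int * diagram)) :=
  [seq (p.1 * q.1, op p.2 q.2) | p <- L1, q <- L2].

Definition lin_comp m := lin_bilin (diag_comp m).
Definition lin_union n1 m1 := lin_bilin (diag_union n1 m1).
Definition lin_opp (L : seq (int * diagram)) := [seq (- p.1, p.2) | p <- L].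

Lemma lincomb_add n m (x y : hom n m) L1 L2 :
  lincomb x L1 -> lincomb y L2 -> lincomb (x + y) (L1 ++ L2).
Proof.
move=> xL yL; elim: xL => [|z C M x' L CM _ IH] /=; first by rewrite add0r.
by rewrite -addrA; apply: lincomb_cons.
Qed.

Lemma lincomb_opp n m (x : hom n m) L : lincomb x L -> lincomb (- x) (lin_opp L).
Proof.
elim=> [|z C M y {}L CM _ IH] /=; first by rewrite oppr0; apply: lincomb_nil.
by rewrite opprD freegUN; apply: lincomb_cons.
Qed.

Lemma lincomb_surface n m (C : cob n m) M :
  represents C M -> lincomb << C >> [:: (1, M)].
Proof.
move=> CM; rewrite -[<< C >>]addr0.
by apply: lincomb_cons => //; apply: lincomb_nil.
Qed.

(** Treats [hom_comp] and [hom_union] at once, both being bilinear extensions of operations on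
    surfaces. *)
Lemma lincomb_bilin n1 m1 n2 m2 n m (op : cob n1 m1 -> cob n2 m2 -> cob n m) dop
    (x : hom n1 m1) (y : hom n2 m2) L1 L2 :
    (forall C D M N, represents C M -> represents D N ->
      represents (op C D) (dop M N)) ->
    lincomb x L1 -> lincomb y L2 ->
  lincomb (fglift (fun C => fglift (fun D => << op C D >> : hom n m) y) x)
          (lin_bilin dop L1 L2).
Proof.
move=> opP; elim=> [|z C M x' {}L1 CM _ IH] yL.
  by rewrite raddf0; apply: lincomb_nil.
rewrite raddfD /= liftU; apply: lincomb_add (IH yL).
elim: yL => [|z' D N y' {}L2 DN _ {}IH] /=.
  by rewrite raddf0 scaler0; apply: lincomb_nil.
rewrite raddfD /= liftU scalerDr scalerA -freegU_scale.
by apply: lincomb_cons => //; apply: opP.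
Qed.

Lemma lincomb_comp n m p (g : hom m p) (f : hom n m) L1 L2 :
  lincomb g L1 -> lincomb f L2 -> lincomb (hom_comp g f) (lin_comp m L1 L2).
Proof. by apply: lincomb_bilin => *; apply: represents_comp. Qed.

Lemma lincomb_union n1 m1 n2 m2 (f : hom n1 m1) (g : hom n2 m2) L1 L2 :
  lincomb f L1 -> lincomb g L2 -> lincomb (hom_union f g) (lin_union n1 m1 L1 L2).
Proof. by apply: lincomb_bilin => *; apply: represents_union. Qed.

Definition lin_connected h : seq (int * diagram) := [:: (1, diag_connected h)].
Definition lin_id n : seq (int * diagram) := [:: (1, diag_id n)].

Lemma lincomb_connected n m h :
  lincomb (<< cob_connected n m h >> : hom n m) (lin_connected h).
Proof. exact/lincomb_surface/represents_connected. Qed.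

Lemma lincomb_id n : lincomb (hom_id n) (lin_id n).
Proof. exact/lincomb_surface/represents_id. Qed.

Definition lin_cap := lin_union 1 1 (lin_id 1) (lin_connected 0).
(** Same code as [lin_cap]: a code does not record how many boundary circles there are. *)
Definition lin_cup := lin_union 1 1 (lin_id 1) (lin_connected 0).

Definition lin_phi (e : bool) :=
  if e then lin_connected 0 ++ lin_opp (lin_comp 1 (lin_connected 1) lin_cap)
  else lin_cap.

Definition lin_phi_inv (e : bool) := if e then lin_cup else lin_connected 0.

Lemma lincomb_phi e : lincomb (phi e) (lin_phi e).
Proof.
have cP : lincomb cap lin_cap.
  exact: lincomb_union (lincomb_id _) (lincomb_connected _ _ _).
rewrite /phi /lin_phi; case: e => //.
apply: lincomb_add; first exact: lincomb_connected.
by apply/lincomb_opp/lincomb_comp => //; apply: lincomb_connected.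
Qed.

Lemma lincomb_phi_inv e : lincomb (phi_inv e) (lin_phi_inv e).
Proof.
have cP : lincomb cup lin_cup.
  exact: lincomb_union (lincomb_id _) (lincomb_connected _ _ _).
by case: e => //; apply: lincomb_connected.
Qed.

(** Plain sequences replace tuples, so that evaluation meets no dependent types. *)
Fixpoint lin_deloop (e : seq bool) : seq (int * diagram) :=
  if e is b :: e' then
    lin_comp (1 + size e') (lin_deloop e')
      (lin_union 2 1 (lin_phi b) (lin_id (size e')))
  else lin_id 1.

Fixpoint lin_deloop_inv (e : seq bool) : seq (int * diagram) :=
  if e is b :: e' then
    lin_comp (1 + size e')
      (lin_union 1 2 (lin_phi_inv b) (lin_id (size e'))) (lin_deloop_inv e')
  else lin_id 1.

Lemma tuple_consE (T : Type) n (t : n.+1.-tuple T) :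
  tval t = thead t :: tval (behead_tuple t).
Proof. by rewrite {1}(tuple_eta t). Qed.

Lemma lincomb_deloop k (e : k.-tuple bool) : lincomb (deloop_entry e) (lin_deloop e).
Proof.
elim: k e => [|k IH] e; first by rewrite tuple0 /=; apply: lincomb_id.
rewrite tuple_consE [deloop_entry _]/= [lin_deloop _]/=.
rewrite -[size _]/(size (behead_tuple e)) size_tuple.
apply: lincomb_comp; first exact: IH.
exact: lincomb_union (lincomb_phi _) (lincomb_id _).
Qed.

Lemma lincomb_deloop_inv k (e : k.-tuple bool) :
  lincomb (deloop_inv_entry e) (lin_deloop_inv e).
Proof.
elim: k e => [|k IH] e; first by rewrite tuple0 /=; apply: lincomb_id.
rewrite tuple_consE [deloop_inv_entry _]/= [lin_deloop_inv _]/=.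
rewrite -[size _]/(size (behead_tuple e)) size_tuple.
apply: lincomb_comp; last exact: IH.
exact: lincomb_union (lincomb_phi_inv _) (lincomb_id _).
Qed.

(** * Matrix entries of induced maps *)

Definition lin_induced k l L (e f : seq bool) : seq (int * diagram) :=
  lin_comp (1 + l) (lin_deloop f) (lin_comp (1 + k) L (lin_deloop_inv e)).

Lemma lincomb_induced k l (x : hom (1 + k) (1 + l)) L
    (e : k.-tuple bool) (f : l.-tuple bool) :
  lincomb x L -> lincomb (induced x e f) (lin_induced k l L e f).
Proof.
move=> xL; rewrite /induced /mat_comp /=.
(* Both intermediate objects have one summand, so each matrix product has one term. *)
rewrite !(big_pred1 tt) => [|[]|[]] //.
apply: lincomb_comp; first exact: lincomb_deloop.
by apply: lincomb_comp => //; apply: lincomb_deloop_inv.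
Qed.

(** Reduces an equality of matrices to one boolean test for each pair of sign sequences. *)
Lemma mat_eq_table k l (x : hom (1 + k) (1 + l))
    (F : seq bool -> seq bool -> hom 1 1) (L : seq (int * diagram)) :
    lincomb x L ->
    (forall e f : seq bool, size e = k -> size f = l ->
      exists2 L', lincomb (F e f) L' &
        lincomb_vanishes 1 1 (lin_induced k l L e f ++ lin_opp L')) ->
  mat_eq (induced x) (table F).
Proof.
move=> xL FL e f; have [L' FL' van] := FL e f (size_tuple e) (size_tuple f).
apply: lincomb_null van; apply: lincomb_add; first exact: lincomb_induced.
exact: lincomb_opp.
Qed.

(** Every table entry is 0, the identity, [H] or [- H]; the first branch finds its code, and the
    test is then run by computation. *)
Ltac entry := eexists;
  [first [exact: lincomb_nil | exact: lincomb_id | exact: lincomb_connected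
         | exact/lincomb_opp/lincomb_connected ]
  | by vm_compute].

Theorem mainTheorem8 :
  [/\ mat_eq
        (@induced 1 2 (hom_union (hom_id 1) << cob_connected 1 2 0 >>))
        (@table 1 2 (fun e f => match e, f with
           | [:: vp], [:: vp; vm] => hom_id 1
           | [:: vp], [:: vm; vp] => hom_id 1
           | [:: vp], [:: vp; vp] => - H
           | [:: vm], [:: vm; vm] => hom_id 1
           | _, _ => 0
           end)),
      mat_eq
        (@induced 2 1 (hom_union (hom_id 1) << cob_connected 2 1 0 >>))
        (@table 2 1 (fun e f => match e, f with
           | [:: vp; vp], [:: vp] => hom_id 1
           | [:: vp; vm], [:: vm] => hom_id 1
           | [:: vm; vp], [:: vm] => hom_id 1
           | [:: vm; vm], [:: vm] => H
           | _, _ => 0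
           end)),
      mat_eq
        (@induced 1 0 << cob_connected 2 1 0 >>)
        (@table 1 0 (fun e f => match e, f with
           | [:: vm], [::] => H
           | [:: vp], [::] => hom_id 1
           | _, _ => 0
           end))
    & mat_eq
        (@induced 0 1 << cob_connected 1 2 0 >>)
        (@table 0 1 (fun e f => match e, f with
           | [::], [:: vm] => hom_id 1
           | _, _ => 0
           end))].
Proof.
split; apply: mat_eq_table.
- exact: lincomb_union (lincomb_id _) (lincomb_connected _ _ _).
(* The sizes leave one source sign and two target signs, hence eight entries to evaluate. *)
- move=> [|a [|? ?]] // [|b [|c [|? ?]]] // _ _; move: a b c; do 3![case]; entry.
- exact: lincomb_union (lincomb_id _) (lincomb_connected _ _ _).
- move=> [|a [|b [|? ?]]] // [|c [|? ?]] // _ _; move: a b c; do 3![case]; entry.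
- exact: lincomb_connected.
- by move=> [|a [|? ?]] // [|? ?] // _ _; case: a; entry.
- exact: lincomb_connected.
- by move=> [|? ?] // [|a [|? ?]] // _ _; case: a; entry.
Qed.
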